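(* Let $F=F_1\times\dots\times F_d$, where each $F_i$ is a closed subset of $[0,1]$ containing $0$ and $1$, and let $P_{F\to[0,1]^d}$ be the multiaffine extension map. 1. The map $f\mapsto P_{F\to[0,1]^d}(f)$ is affine and $1$-Lipschitz from $\mathcal{C}(F,\mathbb{R})$ to $\mathcal{C}([0,1]^d,\mathbb{R})$, both equipped with the $L^\infty$ (sup) norm. In particular, it preserves uniform convergence. 2. If $S$ is a $d$-dimensional subdivision such that $S\cap[0,1]^d\subseteq F$ (where $S$ is identified with the set $\prod_{j=1}^dS_j$), then for all $f\in E_S$, $P_{F\to[0,1]^d}(f_{|F})=f$.
   Context: $\mathcal{C}(A,\mathbb{R})$ denotes continuous functions $A\to\mathbb{R}$. Multiaffine extension: for $f\in\mathcal{C}(F,\mathbb{R})$, $P_{F\to[0,1]^d}(f)$ is the unique continuous $g:[0,1]^d\to\mathbb{R}$ equal to $f$ on $F$ such that for all $i$ and $t\in[0,1]^d$, $u_i\mapsto g(u_i,t_{\sim i})$ is affine on each interval of $[0,1]\setminus F_i$ (here $(u_i,t_{\sim i})$ is $t$ with $i$-th coordinate replaced by $u_i$). Explicitly, $P_{F\to[0,1]^d}(f)(t)=\sum_{\epsilon\in\{-,+\}^d}\big(\prod_{j=1}^d\omega_{\epsilon_j}(t_j)\big)f(t_1^{\epsilon_1},\dots,t_d^{\epsilon_d})$, with $t_j^-=\max\{u\in F_j:u\le t_j\}$, $t_j^+=\min\{u\in F_j:u\ge t_j\}$, $\omega_+(t_j)=\frac{t_j-t_j^-}{t_j^+-t_j^-}$,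 $\omega_-(t_j)=1-\omega_+(t_j)$ if $t_j\notin F_j$, and $\omega_\pm(t_j)=\frac12$ if $t_j\in F_j$. Subdivisions: a one-dimensional subdivision is a finite set $S\subset\mathbb{R}$ with ordered elements $-1=t^{(S)}_{(0)}<0=t^{(S)}_{(1)}<\dots<t^{(S)}_{(m_S)}=1<t^{(S)}_{(m_S+1)}=2$; a $d$-dimensional subdivision is a vector $S=(S_1,\dots,S_d)$ of such sets. For $u<v<w$, $\phi_{u,v,w}(t)=\frac{t-u}{v-u}$ for $u\le t\le v$, $\frac{w-t}{w-v}$ for $v\le t\le w$, $0$ otherwise. $E_S$ is the linear span of the functions $\phi^{(S)}_{\underline\ell}:[0,1]^d\to\mathbb{R}$, $\phi^{(S)}_{\underline\ell}(t)=\prod_{i=1}^d\phi_{t^{(S_i)}_{(\ell_i-1)},t^{(S_i)}_{(\ell_i)},t^{(S_i)}_{(\ell_i+1)}}(t_i)$, for $\underline\ell\in\prod_{i=1}^d\{1,\dots,m_{S_i}\}$. *)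

(* Defs.v *)
From HB Require Import structures.
From mathcomp Require Import all_boot all_order all_algebra.
From mathcomp Require Import all_classical all_reals all_analysis.

Set Implicit Arguments.
Unset Strict Implicit.
Unset Printing Implicit Defensive.

Import Order.TTheory GRing.Theory Num.Theory.
Import numFieldNormedType.Exports.

Local Open Scope classical_set_scope.
Local Open Scope ring_scope.

(* Points of R^d are row vectors. A real function on a subset A of R^d is
   represented by a total function of which only the values on A matter, and
   "f belongs to C(A, R)" is [{within A, continuous f}]. *)

Section Defs.
Context {R : realType}.

Definition prod_set d (A : 'I_d -> set R) : set 'rV[R]_d :=
  [set t | forall i, A i (t ord0 i)].

Definition unit_cube d : set 'rV[R]_d := prod_set (fun=> `[0, 1]%classic).

Definition set_coord d (t : 'rV[R]_d) (i : 'I_d) (u : R) : 'rV[R]_d :=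
  \row_j (if j == i then u else t ord0 j).

Definition affine_on (I : set R) (h : R -> R) : Prop :=
  exists p q : R, forall u, I u -> h u = p * u + q.

Definition is_multiaffine_extension d (F : 'I_d -> set R)
    (f g : 'rV[R]_d -> R) : Prop :=
  [/\ {within @unit_cube d, continuous g},
      forall t, prod_set F t -> g t = f t &
      forall (i : 'I_d) (t : 'rV[R]_d), unit_cube t ->
        forall I : set R, is_interval I -> I `<=` `[0, 1]%classic `\` F i ->
          affine_on I (fun u => g (set_coord t i u))].

(* The definite description "the continuous extension of f that is affine in
   each coordinate on the gaps of F". It pins down the values on the unit cube
   only; when no such extension exists it defaults to the zero function. *)
Definition multiaffine_extension d (F : 'I_d -> set R)
    (f : 'rV[R]_d -> R) : 'rV[R]_d -> R :=
  xget (fun=> 0) [set g | is_multiaffine_extension F f g].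

(* Real-valued, hence meaningful only if h is bounded on A. *)
Definition sup_norm d (A : set 'rV[R]_d) (h : 'rV[R]_d -> R) : R :=
  sup [set `|h t| | t in A].

(* A one-dimensional subdivision is given by its increasing enumeration
   t_(0) = -1 < t_(1) = 0 < ... < t_(m) = 1 < t_(m+1) = 2, of length m + 2. *)
Definition subdiv_size (s : seq R) : nat := (size s).-2.

Definition is_subdivision (s : seq R) : Prop :=
  [/\ sorted <%R s, s`_0 = -1, s`_1 = 0,
      s`_(subdiv_size s) = 1 & s`_(subdiv_size s).+1 = 2].

Definition hat (u v w t : R) : R :=
  if u <= t <= v then (t - u) / (v - u)
  else if v <= t <= w then (w - t) / (w - v)
  else 0.

(* The multi-indices range over prod_i {1, ..., m_(S_i)}; the component
   [l i : 'I_(m_(S_i))] stands for the index [(l i).+1]. *)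
Definition subdiv_index d (S : 'I_d -> seq R) : finType :=
  {dffun forall i : 'I_d, 'I_(subdiv_size (S i))}.

Definition subdiv_basis d (S : 'I_d -> seq R) (l : subdiv_index S)
    (t : 'rV[R]_d) : R :=
  \prod_(i < d) hat (S i)`_(l i) (S i)`_(l i).+1 (S i)`_(l i).+2 (t ord0 i).

Definition subdiv_span d (S : 'I_d -> seq R) : set ('rV[R]_d -> R) :=
  [set f | exists c : subdiv_index S -> R, forall t, unit_cube t ->
     f t = \sum_(l : subdiv_index S) c l * subdiv_basis l t].

End Defs.

(* Main.v *)
Require Import Defs.
From HB Require Import structures.
From mathcomp Require Import all_boot all_order all_algebra.
From mathcomp Require Import all_classical all_reals all_analysis.
From mathcomp Require Import zify ring lra.

Set Implicit Arguments.
Unset Strict Implicit.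
Unset Printing Implicit Defensive.

Import Order.TTheory GRing.Theory Num.Theory.
Import numFieldNormedType.Exports.

Local Open Scope classical_set_scope.
Local Open Scope ring_scope.

(** The extension is built one coordinate at a time.  For a closed set K of
    knots in [0, 1] containing both endpoints, [interp K i g] replaces g by its
    linear interpolation in the i-th coordinate between the two neighbouring
    knots; iterating over all coordinates ([interp_coords]) yields the explicit
    multiaffine formula.

    One step turns a bounded continuous function on a product whose i-th factor
    is K into a continuous function on the product with that factor enlarged to
    [0, 1] ([interp_continuous]); this is the only delicate point, since the
    neighbouring knots of u jump as u varies.  A step is linear, does not
    increase the sup norm, leaves the values over K unchanged, and is affine on
    the gaps of K.  Hence the iterate is a multiaffine extension
    ([interp_coords_is_extension]).

    Conversely, any multiaffine extension g of f is affine on the open gap around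
    each coordinate, hence by continuity on the closed gap, so every step fixes g
    ([extension_interp_id]).  Applying all the steps gives g = [interp_coords] g,
    which depends on the values on the product of the knot sets only; so
    extensions are unique ([extension_unique]) and inherit linearity and
    contraction from [interp_coords].  The Lipschitz bound and the preservation
    of uniform convergence are the contraction property.

    Finally, a tensor product of hat functions is continuous and affine in each
    coordinate away from the subdivision points, and those lying in [0, 1] are
    knots.  An element of the span is therefore itself a multiaffine extension of
    its restriction, and uniqueness concludes. *)

(** * Neighbouring knots of a point of the unit interval *)

Section Neighbours.
Variable R : realType.
Implicit Types (K : set R) (a b u v x : R).

Definition knot_set K : Prop :=
  [/\ closed K, K `<=` `[0, 1]%classic, K 0 & K 1].

Definition lower K u : R := sup (K `&` [set x | x <= u]).
Definition upper K u : R := inf (K `&` [set x | u <= x]).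

(** The weight of the right neighbour.  At a knot both neighbours coincide and
    0 / 0 = 0, so the single formula also covers that case: any weight would give
    the same interpolant there. *)
Definition weight K u : R := (u - lower K u) / (upper K u - lower K u).

Lemma lowerP K u : knot_set K -> 0 <= u ->
  [/\ K (lower K u), lower K u <= u & forall x, K x -> x <= u -> x <= lower K u].
Proof.
move=> [Kc _ K0 _] u0; set E := K `&` [set x | x <= u].
have E0 : E 0 by [].
have Eub : has_ubound E by exists u => x [].
have Ecl : closed E by apply: closedI => //; exact: closed_le.
have [KE leE] : E (sup E).
  by have := closure_sup (ex_intro E 0 E0) Eub; rewrite -(proj1 (closure_id E)).
by split=> // x Kx xu; apply: ub_le_sup.
Qed.

Lemma upperP K u : knot_set K -> u <= 1 ->
  [/\ K (upper K u), u <= upper K u & forall x, K x -> u <= x -> upper K u <= x].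
Proof.
move=> [Kc _ _ K1] u1; set E := K `&` [set x | u <= x].
have E1 : E 1 by [].
have Elb : has_lbound E by exists u => x [].
have Ecl : closed E by apply: closedI => //; exact: closed_ge.
have [KE leE] : E (inf E).
  apply: itv_closed_infimums => //; first by exists 1.
  split; first exact: ge_inf.
  by move=> x Ex; apply: lb_le_inf => //; exists 1.
by split=> // x Kx xu; apply: ge_inf.
Qed.

Lemma knot01 K x : knot_set K -> K x -> 0 <= x <= 1.
Proof. by move=> [_ sub _ _] /sub; rewrite /= in_itv. Qed.

Lemma lower_id K u : knot_set K -> K u -> lower K u = u.
Proof.
move=> HK Ku; have /andP[u0 _] := knot01 HK Ku; have [_ h1 h2] := lowerP HK u0.
by apply: le_anti; rewrite h1 h2.
Qed.

Lemma weight_id K u : knot_set K -> K u -> weight K u = 0.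
Proof. by move=> HK Ku; rewrite /weight lower_id// subrr mul0r. Qed.

Lemma weight01 K u : knot_set K -> 0 <= u <= 1 -> 0 <= weight K u <= 1.
Proof.
move=> HK /andP[u0 u1]; have [_ h1 _] := lowerP HK u0; have [_ h2 _] := upperP HK u1.
rewrite /weight; have [e|ne] := eqVneq (upper K u) (lower K u).
  by rewrite e subrr invr0 mulr0 lexx ler01.
have p : 0 < upper K u - lower K u by rewrite subr_gt0 lt_neqAle eq_sym ne; lra.
by rewrite divr_ge0 ?ler_pdivrMr//=; lra.
Qed.

Lemma gap_bounds K u : knot_set K -> 0 <= u <= 1 -> ~ K u ->
  lower K u < u < upper K u.
Proof.
move=> HK /andP[u0 u1] nK; have [K1 h1 _] := lowerP HK u0.
have [K2 h2 _] := upperP HK u1.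
have ne1 : lower K u != u by apply/eqP => e; apply: nK; rewrite -e.
have ne2 : u != upper K u by apply/eqP => e; apply: nK; rewrite e.
by rewrite (lt_neqAle u) (lt_neqAle (lower K u)) ne1 ne2 h1 h2.
Qed.

Lemma gap_const K u v : knot_set K -> 0 <= u <= 1 ->
  lower K u < v < upper K u -> lower K v = lower K u /\ upper K v = upper K u.
Proof.
move=> HK /andP[u0 u1] /andP[av vb].
have [Ka au maxa] := lowerP HK u0; have [Kb ub minb] := upperP HK u1.
have /andP[a0 _] := knot01 HK Ka; have /andP[_ b1] := knot01 HK Kb.
have v0 : 0 <= v by lra.
have v1 : v <= 1 by lra.
have [Ka' av' maxa'] := lowerP HK v0; have [Kb' vb' minb'] := upperP HK v1.
have h1 := maxa' _ Ka (ltW av); have h2 := minb' _ Kb (ltW vb).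
split; apply: le_anti; apply/andP; split=> //.
- have [le|lt] := leP (lower K v) u; first exact: maxa.
  by have := minb _ Ka' (ltW lt); lra.
- have [le|lt] := leP u (upper K v); first exact: minb.
  by have := maxa _ Kb' (ltW lt); lra.
Qed.

(** An interval that avoids the knots cannot jump over one, so it lies in a single
    gap; this is what makes the neighbours constant on it. *)
Lemma sub_gap K u v (I : set R) : knot_set K -> is_interval I ->
  I `<=` `[0, 1]%classic `\` K -> I u -> I v -> lower K u < v < upper K u.
Proof.
move=> HK itvI subI Iu Iv; have [/=] := subI _ Iu; rewrite in_itv /= => u01 nKu.
have /andP[u0 u1] := u01.
have [Ka au maxa] := lowerP HK u0; have [Kb ub minb] := upperP HK u1.
apply/andP; split; rewrite ltNge; apply/negP => le.
- have : I (lower K u) by apply: (itvI v u) => //; rewrite le.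
  by move=> /subI[].
- have : I (upper K u) by apply: (itvI u v) => //; rewrite ub.
  by move=> /subI[].
Qed.

Lemma norm_convex_le (w a b M N : R) : 0 <= w <= 1 ->
  (1 - w) * `|a| <= M -> w * `|b| <= N -> `|(1 - w) * a + w * b| <= M + N.
Proof.
move=> /andP[w0 w1] h1 h2; apply: le_trans (ler_normD _ _) _.
by rewrite !normrM (ger0_norm w0) ger0_norm ?subr_ge0// lerD.
Qed.

End Neighbours.

(** * Interpolation in one coordinate *)

Section Interp.
Variables (R : realType) (d : nat).
Implicit Types (K : set R) (A : 'I_d -> set R) (t s : 'rV[R]_d) (i j : 'I_d)
  (f g : 'rV[R]_d -> R).

Lemma set_coordE t i u j : set_coord t i u ord0 j = if j == i then u else t ord0 j.
Proof. by rewrite mxE. Qed.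

Lemma set_coord_id t i : set_coord t i (t ord0 i) = t.
Proof. by apply/rowP => j; rewrite mxE; case: eqP => [->|]. Qed.

Lemma set_coord_set t i u v : set_coord (set_coord t i u) i v = set_coord t i v.
Proof. by apply/rowP => j; rewrite !mxE; case: eqP. Qed.

Lemma set_coordC t i j u v : i != j ->
  set_coord (set_coord t i u) j v = set_coord (set_coord t j v) i u.
Proof.
move=> ij; apply/rowP => k; rewrite !mxE; have [->|//] := eqVneq k j.
by rewrite eq_sym (negbTE ij).
Qed.

(** Moduli are measured coordinatewise, which is how points differing in one
    coordinate are compared below. *)
Lemma within_continuous_rVP (B : set 'rV[R]_d) f :
  {within B, continuous f} <->
  forall t, B t -> forall e, 0 < e -> exists2 r, 0 < r &
    forall s, B s -> (forall j, `|t ord0 j - s ord0 j| < r) -> `|f t - f s| < e.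
Proof.
rewrite subspace_continuousP; split=> [h t Bt e e0|h t Bt].
- have /cvgrPdist_lt/(_ e e0) := h t Bt.
  rewrite near_withinE => /nbhs_ballP[r /= r0 sub]; exists r => // s Bs near.
  by apply: sub => //; split=> // k j; rewrite !ord1; apply: near.
- apply/cvgrPdist_lt => e e0; have [r r0 hr] := h t Bt e e0.
  rewrite near_withinE; apply/nbhs_ballP; exists r => //= s [_ near] Bs.
  by apply: hr => // j; apply: near.
Qed.

Definition interp K i g t : R :=
  (1 - weight K (t ord0 i)) * g (set_coord t i (lower K (t ord0 i)))
  + weight K (t ord0 i) * g (set_coord t i (upper K (t ord0 i))).

Definition widen A i : 'I_d -> set R :=
  fun j => if j == i then `[0, 1]%classic else A j.

Lemma widen_coord A i t : prod_set (widen A i) t -> 0 <= t ord0 i <= 1.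
Proof. by move=> /(_ i); rewrite /widen eqxx /= in_itv. Qed.

Lemma widen_set_coord A i t x :
  prod_set (widen A i) t -> A i x -> prod_set A (set_coord t i x).
Proof.
move=> At Ax j; rewrite set_coordE; have := At j; rewrite /widen.
by case: eqP => [->|].
Qed.

Lemma interp_id K i g t : knot_set K -> K (t ord0 i) -> interp K i g t = g t.
Proof.
by move=> HK Kt; rewrite /interp weight_id// lower_id// set_coord_id; ring.
Qed.

Lemma interp_linear K i a b f g t :
  interp K i (fun x => a * f x + b * g x) t
  = a * interp K i f t + b * interp K i g t.
Proof. by rewrite /interp; ring. Qed.

Lemma interp_bounded A i g M : knot_set (A i) ->
  (forall t, prod_set A t -> `|g t| <= M) ->
  forall t, prod_set (widen A i) t -> `|interp (A i) i g t| <= M.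
Proof.
move=> HK gM t At; have t01 := widen_coord At.
have /andP[w0 w1] := weight01 HK t01; have /andP[t0 t1] := t01.
have [Ka _ _] := lowerP HK t0; have [Kb _ _] := upperP HK t1.
have -> : M = (1 - weight (A i) (t ord0 i)) * M + weight (A i) (t ord0 i) * M by ring.
apply: norm_convex_le; rewrite ?w0//; apply: ler_wpM2l; rewrite ?subr_ge0//;
  apply: gM; exact: widen_set_coord.
Qed.

(** The value at s is a convex combination of the values of g at s with its i-th
    coordinate v moved to the knots a <= v <= b next to it; let u be the i-th
    coordinate of t.  If u is not a knot, then a and b are locally constant and only
    the weights move.  If u is a knot, each of a and b is either close to u, where
    continuity of g at t applies, or far from u; in the latter case v, being close
    to u, is much closer to the other neighbour, so the far one has a small weight,
    which the bound on g turns into a small contribution. *)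
Lemma interp_continuous A i g M : knot_set (A i) ->
  (forall t, prod_set A t -> `|g t| <= M) ->
  {within prod_set A, continuous g} ->
  {within prod_set (widen A i), continuous (interp (A i) i g)}.
Proof.
move=> HK gM0 /within_continuous_rVP gC; apply/within_continuous_rVP => t Bt e e0.
pose N := `|M| + 1.
have N0 : 0 < N by rewrite /N; have := normr_ge0 M; lra.
have gN x y : prod_set A x -> prod_set A y -> `|g x - g y| <= 2 * N.
  move=> /gM0 hx /gM0 hy; apply: le_trans (ler_normB _ _) _.
  by have := ler_norm M; rewrite /N; lra.
have e4 : 0 < e / 4 by lra.
set u := t ord0 i; have u01 : 0 <= u <= 1 := widen_coord Bt.
have /andP[u0 u1] := u01.
have [Ku|nKu] := pselect (A i u).
- have At : prod_set A t by rewrite -(set_coord_id t i); exact: widen_set_coord.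
  have [r r0 hr] := gC t At _ e4.
  (* a far knot gets weight at most r' / (r / 2), and values differ by at most
     2 N, hence the second bound *)
  pose r' := Num.min (r / 2) (e / 4 * r / (4 * N)).
  have r'1 : r' <= r / 2 by rewrite /r' ge_min lexx.
  have r'2 : r' * (4 * N) <= e / 4 * r.
    by rewrite -ler_pdivlMr ?mulr_gt0// /r' ge_min lexx orbT.
  exists r'; first by rewrite lt_min !divr_gt0 ?mulr_gt0//; lra.
  move=> s Bs near; rewrite interp_id//.
  have near' x : `|u - x| < r -> forall j, `|t ord0 j - set_coord s i x ord0 j| < r.
    by move=> ux j; rewrite set_coordE; case: eqP => [->//|_]; have := near j; lra.
  rewrite /interp; set v := s ord0 i; have v01 : 0 <= v <= 1 := widen_coord Bs.
  have := near i; rewrite -/u -/v ltr_norml => /andP[uv1 uv2].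
  have /andP[v0 v1] := v01.
  have [Ka av maxa] := lowerP HK v0; have [Kb vb minb] := upperP HK v1.
  have /andP[w0 w1] := weight01 HK v01.
  have := erefl (weight (A i) v); rewrite {1}/weight.
  move: (weight (A i) v) w0 w1 => w w0 w1.
  move: (lower (A i) v) (upper (A i) v) Ka av maxa Kb vb minb => a b Ka av maxa Kb vb minb ew.
  have ew' : w * (b - a) = v - a.
    rewrite -ew; have [eab|ne] := eqVneq b a; first by rewrite eab subrr mulr0; lra.
    by rewrite mulfVK// subr_eq0.
  have term p x : 0 <= p -> A i x -> p * (r / 2) <= r' \/ `|u - x| < r ->
      p * `|g t - g (set_coord s i x)| <= p * (e / 4) + e / 4.
    move=> p0 Kx [pr|/near' hx].
    - have : p * `|g t - g (set_coord s i x)| <= p * (2 * N).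
        by rewrite ler_wpM2l// gN//; exact: widen_set_coord.
      have : (p * (2 * N)) * r <= e / 4 * r.
        by apply: le_trans r'2; have := ler_wpM2r (ltW (mulr_gt0 (ltr0Sn R 3) N0)) pr; lra.
      rewrite ler_pM2r// => h1 h2; apply: le_trans h2 _; apply: le_trans h1 _.
      by rewrite lerDr mulr_ge0// ltW.
    - apply: le_trans (_ : p * (e / 4) <= _); last by rewrite lerDl ltW.
      by rewrite ler_wpM2l// ltW// hr//; exact: widen_set_coord.
  have -> : g t - ((1 - w) * g (set_coord s i a) + w * g (set_coord s i b))
     = (1 - w) * (g t - g (set_coord s i a)) + w * (g t - g (set_coord s i b)).
    by ring.
  apply: le_lt_trans (_ : ((1 - w) * (e / 4) + e / 4) + (w * (e / 4) + e / 4) < e); last lra.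
  apply: norm_convex_le; rewrite ?w0//; apply: term; rewrite ?subr_ge0//.
  + have [far|] := leP r `|u - a|; [left|by right].
    have [uv|vu] := leP u v.
      have := maxa _ Ku uv => ua; move: far; rewrite ler0_norm; lra.
    have := minb _ Ku (ltW vu) => bu.
    move: far; rewrite ger0_norm; last lra.
    move=> far; have : (1 - w) * (r / 2) <= (1 - w) * (b - a) by rewrite ler_wpM2l//; lra.
    lra.
  + have [far|] := leP r `|u - b|; [left|by right].
    have [vu|uv] := leP v u.
      have := minb _ Ku vu => ub; move: far; rewrite ger0_norm; lra.
    have := maxa _ Ku (ltW uv) => bu.
    move: far; rewrite ler0_norm; last lra.
    move=> far; have : w * (r / 2) <= w * (b - a) by rewrite ler_wpM2l//; lra.
    lra.
- have [Ka _ _] := lowerP HK u0; have [Kb _ _] := upperP HK u1.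
  have /andP[au ub] := gap_bounds HK u01 nKu.
  have gapc v := @gap_const _ _ _ v HK u01.
  have eint s : lower (A i) u < s ord0 i < upper (A i) u -> interp (A i) i g s =
     let w := (s ord0 i - lower (A i) u) / (upper (A i) u - lower (A i) u) in
     (1 - w) * g (set_coord s i (lower (A i) u)) + w * g (set_coord s i (upper (A i) u)).
    by move=> /gapc[h1 h2]; rewrite /interp /weight h1 h2.
  rewrite eint -?/u ?au//=.
  move: (lower (A i) u) (upper (A i) u) Ka Kb au ub eint {gapc} =>
    a b Ka Kb au ub eint.
  have Ata := widen_set_coord Bt Ka; have Atb := widen_set_coord Bt Kb.
  have [r1 r10 hr1] := gC _ Ata _ e4; have [r2 r20 hr2] := gC _ Atb _ e4.
  have ba : 0 < b - a by lra.
  (* stay within the moduli at both endpoints and inside the gap, and keep the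
     variation of the weight times 2 N below e / 4 *)
  pose r' := Num.min (Num.min r1 r2)
     (Num.min (Num.min (u - a) (b - u)) (e / 4 * (b - a) / (2 * N))).
  have : r' <= r' by []; rewrite {2}/r' !le_min => /andP[/andP[lr1 lr2] /andP[/andP[lra lrb] lrN]].
  exists r'; first by rewrite !lt_min !subr_gt0 r10 r20 au ub divr_gt0 ?mulr_gt0//; lra.
  move=> s Bs near; set v := s ord0 i.
  have := near i; rewrite -/u -/v => uvn; have := uvn; rewrite ltr_norml => /andP[uv1 uv2].
  rewrite eint -/v /=; last lra.
  have near' x r j : r' <= r -> 0 < r -> `|set_coord t i x ord0 j - set_coord s i x ord0 j| < r.
    move=> rr r0; rewrite !set_coordE; case: eqP => _; first by rewrite subrr normr0.
    exact: lt_le_trans (near j) rr.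
  have ha : `|g (set_coord t i a) - g (set_coord s i a)| < e / 4.
    by apply: hr1 => [|j]; [exact: widen_set_coord|exact: near'].
  have hb : `|g (set_coord t i b) - g (set_coord s i b)| < e / 4.
    by apply: hr2 => [|j]; [exact: widen_set_coord|exact: near'].
  set w := (v - a) / (b - a).
  have w01 : 0 <= w <= 1 by rewrite /w divr_ge0 ?ler_pdivrMr//=; lra.
  have -> : (u - a) / (b - a) = w + (u - v) / (b - a) by rewrite /w; field; rewrite gt_eqF.
  set q := (u - v) / (b - a).
  have -> : (1 - (w + q)) * g (set_coord t i a) + (w + q) * g (set_coord t i b)
    - ((1 - w) * g (set_coord s i a) + w * g (set_coord s i b))
    = ((1 - w) * (g (set_coord t i a) - g (set_coord s i a))
      + w * (g (set_coord t i b) - g (set_coord s i b)))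
      + q * (g (set_coord t i b) - g (set_coord t i a)) by ring.
  apply: le_lt_trans (ler_normD _ _) _.
  have /andP[w0 w1] := w01.
  have : `|(1 - w) * (g (set_coord t i a) - g (set_coord s i a))
      + w * (g (set_coord t i b) - g (set_coord s i b))| <= (1 - w) * (e / 4) + w * (e / 4).
    by apply: norm_convex_le => //; rewrite ler_wpM2l ?subr_ge0// ltW.
  have : `|q * (g (set_coord t i b) - g (set_coord t i a))| <= e / 4.
    rewrite normrM; apply: le_trans (ler_wpM2l (normr_ge0 _) (gN _ _ Atb Ata)) _.
    rewrite /q normrM normfV (gtr0_norm ba) mulrAC ler_pdivrMr//.
    rewrite -ler_pdivlMr ?mulr_gt0//; lra.
  lra.
Qed.

Lemma interp_affine K i g t (I : set R) : knot_set K ->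
  is_interval I -> I `<=` `[0, 1]%classic `\` K ->
  affine_on I (fun u => interp K i g (set_coord t i u)).
Proof.
move=> HK itvI subI; have [[u0 Iu0]|I0] := pselect (exists u, I u); last first.
  by exists 0, 0 => u Iu; case: I0; exists u.
have [/=] := subI _ Iu0; rewrite in_itv /= => u001 _.
set a := lower K u0; set b := upper K u0.
set ga := g (set_coord t i a); set gb := g (set_coord t i b).
exists ((gb - ga) / (b - a)), (ga - a / (b - a) * (gb - ga)) => u Iu.
have /(gap_const HK u001)[ea eb] := sub_gap HK itvI subI Iu0 Iu.
by rewrite /interp set_coordE eqxx !set_coord_set /weight ea eb -/a -/b -/ga -/gb; ring.
Qed.

Lemma interp_affine_other K i j g t (I : set R) : j != i ->
  (forall t, affine_on I (fun u => g (set_coord t j u))) ->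
  affine_on I (fun u => interp K i g (set_coord t j u)).
Proof.
move=> ji gI; rewrite /interp; set w := weight K (t ord0 i).
have [p [q hp]] := gI (set_coord t i (lower K (t ord0 i))).
have [p' [q' hp']] := gI (set_coord t i (upper K (t ord0 i))).
exists ((1 - w) * p + w * p'), ((1 - w) * q + w * q') => u Iu.
rewrite !set_coordE eq_sym (negbTE ji) -/w.
rewrite !(set_coordC _ _ _ ji) hp// hp'//; ring.
Qed.

End Interp.

(** * The extension over all coordinates, and its uniqueness *)

Section Extension.
Variables (R : realType) (d : nat) (F : 'I_d -> set R).
Hypothesis F_knots : forall i, knot_set (F i).
Implicit Types (t s : 'rV[R]_d) (i j : 'I_d) (f g : 'rV[R]_d -> R) (r : seq 'I_d).

(** The factors of the domain reached once the coordinates in r have been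
    interpolated. *)
Definition cells r : 'I_d -> set R :=
  fun j => if j \in r then `[0, 1]%classic else F j.

Definition interp_coords r f : 'rV[R]_d -> R :=
  foldr (fun i => interp (F i) i) f r.

Lemma cells_cons i r : cells (i :: r) = widen (cells r) i.
Proof. by apply/funext => j; rewrite /cells /widen in_cons; case: eqP. Qed.

Lemma cells_notin i r : i \notin r -> cells r i = F i.
Proof. by rewrite /cells => /negbTE ->. Qed.

Lemma prod_cells_enum : prod_set (cells (enum 'I_d)) = @unit_cube R d.
Proof. by congr prod_set; apply/funext => j; rewrite /cells mem_enum. Qed.

Lemma prod_sub_cube t : prod_set F t -> unit_cube t.
Proof. by move=> Ft i; have [_ sub _ _] := F_knots i; exact: sub. Qed.

Lemma interp_coords_linear r a b f g t :
  interp_coords r (fun x => a * f x + b * g x) t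
  = a * interp_coords r f t + b * interp_coords r g t.
Proof.
elim: r t => //= i r IH t; rewrite -interp_linear.
by congr interp; apply/funext => x; exact: IH.
Qed.

Lemma interp_coords_bounded r f M : uniq r ->
  (forall t, prod_set F t -> `|f t| <= M) ->
  forall t, prod_set (cells r) t -> `|interp_coords r f t| <= M.
Proof.
move=> + fM; elim: r => [_|i r IH /= /andP[ir /IH{}IH]]; first exact: fM.
rewrite cells_cons -(cells_notin ir); apply: interp_bounded => //.
by rewrite cells_notin.
Qed.

Lemma interp_coords_dist r f g M : uniq r ->
  (forall t, prod_set F t -> `|f t - g t| <= M) ->
  forall t, prod_set (cells r) t ->
    `|interp_coords r f t - interp_coords r g t| <= M.
Proof.
move=> ur fgM t rt; have := @interp_coords_linear r 1 (-1) f g t.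
rewrite mul1r mulN1r => <-; apply: interp_coords_bounded t rt => // t Ft.
by rewrite mul1r mulN1r; exact: fgM.
Qed.

Lemma prod_compact : compact (prod_set F).
Proof.
apply: rV_compact => i; have [Fc sub _ _] := F_knots i.
by apply: (subclosed_compact Fc (@segment_compact _ 0 1)).
Qed.

Lemma continuous_prod_bounded f : {within prod_set F, continuous f} ->
  exists M, forall t, prod_set F t -> `|f t| <= M.
Proof.
move=> fC; have /compact_bounded[M [_ hM]] := continuous_compact fC prod_compact.
exists (`|M| + 1) => t Ft; apply: hM; last by exists t.
by have := ler_norm M; lra.
Qed.

Lemma interp_coords_continuous r f : uniq r -> {within prod_set F, continuous f} ->
  {within prod_set (cells r), continuous (interp_coords r f)}.
Proof.
move=> + fC; have [M fM] := continuous_prod_bounded fC.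
elim: r => [_|i r IH /= /andP[ir ur]]; first exact: fC.
rewrite cells_cons -(cells_notin ir); apply: (@interp_continuous _ _ _ _ _ M).
- by rewrite cells_notin.
- exact: interp_coords_bounded.
- exact: IH.
Qed.

Lemma interp_coords_id r f t : prod_set F t -> interp_coords r f t = f t.
Proof. by move=> Ft; elim: r => //= i r IH; rewrite interp_id. Qed.

Lemma interp_coords_affine r f i t (I : set R) : i \in r ->
  is_interval I -> I `<=` `[0, 1]%classic `\` F i ->
  affine_on I (fun u => interp_coords r f (set_coord t i u)).
Proof.
move=> + itvI subI; elim: r t => //= j r IH t; rewrite in_cons.
have [<- _|ij /= ir] := eqVneq i j; first exact: interp_affine.
by apply: interp_affine_other => // t'; exact: IH.
Qed.

Lemma interp_coords_is_extension f : {within prod_set F, continuous f} ->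
  is_multiaffine_extension F f (interp_coords (enum 'I_d) f).
Proof.
move=> fC; split=> [|t Ft|i t _ I itvI subI].
- by rewrite -prod_cells_enum; apply: interp_coords_continuous; rewrite ?enum_uniq.
- exact: interp_coords_id.
- by apply: interp_coords_affine; rewrite ?mem_enum.
Qed.

Lemma cube_set_coord t i x : unit_cube t -> 0 <= x <= 1 -> unit_cube (set_coord t i x).
Proof. by move=> ct x01 j; rewrite set_coordE; case: eqP => // _; rewrite /= in_itv. Qed.

(** Both sides of the affine identity are continuous in the i-th coordinate. *)
Lemma affine_closure g i t (I : set R) p q c :
  {within @unit_cube R d, continuous g} -> unit_cube t ->
  I `<=` `[0, 1]%classic -> (forall u, I u -> g (set_coord t i u) = p * u + q) ->
  closure I c -> 0 <= c <= 1 -> g (set_coord t i c) = p * c + q.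
Proof.
move=> /within_continuous_rVP gC ct subI gI clc c01.
have ctc := cube_set_coord i ct c01.
apply/eqP; rewrite -subr_eq0 -normr_le0; apply/ler_addgt0Pr => e e0; rewrite add0r.
have e2 : 0 < e / 2 by lra.
have [r r0 hr] := gC _ ctc _ e2.
pose r' := Num.min r (e / 2 / (`|p| + 1)).
have p1 : 0 < `|p| + 1 by have := normr_ge0 p; lra.
have r'0 : 0 < r' by rewrite lt_min r0 divr_gt0.
have [u [Iu]] := clc _ (nbhsx_ballx c r' r'0).
rewrite /ball /= /r' lt_min => /andP[ur ue].
have u01 : 0 <= u <= 1 by have := subI _ Iu; rewrite /= in_itv.
have := hr _ (cube_set_coord i ct u01); rewrite (gI _ Iu) => hu.
have {}hu : `|g (set_coord t i c) - (p * u + q)| < e / 2.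
  by apply: hu => j; rewrite !set_coordE; case: eqP => // _; rewrite subrr normr0.
have hp : `|p * (u - c)| <= e / 2.
  rewrite normrM distrC; move: ue; rewrite ltr_pdivlMr// => ue.
  by have := normr_ge0 (c - u); lra.
have -> : g (set_coord t i c) - (p * c + q)
   = (g (set_coord t i c) - (p * u + q)) + p * (u - c) by ring.
by apply: le_trans (ler_normD _ _) _; lra.
Qed.

Lemma closure_itv_oo (a b c : R) : a < b -> a <= c <= b -> closure `]a, b[%classic c.
Proof.
move=> ab /andP[ac cb] B /nbhs_ballP[r /= r0 subB].
pose h := Num.min (1 / 2) (r / (2 * (b - a))).
have ba : 0 < 2 * (b - a) by lra.
have h0 : 0 < h by rewrite lt_min (divr_gt0 r0 ba) andbT; lra.
have h2 : h <= 1 / 2 by rewrite ge_min lexx.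
have hr : h * (b - a) <= r / 2.
  rewrite -ler_pdivlMr ?subr_gt0// ge_min; apply/orP; right.
  by rewrite invfM mulrA lexx.
have hac : 0 <= h * (c - a) by rewrite mulr_ge0 ?subr_ge0 ?(ltW h0).
have hcb : 0 <= h * (b - c) by rewrite mulr_ge0 ?subr_ge0 ?(ltW h0).
have hba : 0 < h * (b - a) by rewrite mulr_gt0 ?subr_gt0.
have hac' : h * (c - a) <= 1 / 2 * (c - a) by rewrite ler_wpM2r//; lra.
have hcb' : h * (b - c) <= 1 / 2 * (b - c) by rewrite ler_wpM2r//; lra.
(* the point h of the way from c to the midpoint of the interval *)
exists (c + h * ((a + b) / 2 - c)); split.
  by rewrite /= in_itv /=; lra.
by apply: subB; rewrite /ball /= ltr_norml; lra.
Qed.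

(** On the open gap around the i-th coordinate g is affine; by continuity the same
    affine formula holds at both ends of the gap, which is exactly to say that g is
    its own interpolant. *)
Lemma extension_interp_id f g i t : is_multiaffine_extension F f g -> unit_cube t ->
  interp (F i) i g t = g t.
Proof.
move=> [gC _ gaff] ct; set u := t ord0 i.
have u01 : 0 <= u <= 1 by have := ct i; rewrite /= in_itv.
have [Fu|nFu] := pselect (F i u); first exact: interp_id.
have /andP[au ub] := gap_bounds (F_knots i) u01 nFu.
have /andP[u0 u1] := u01.
have [Ka _ maxa] := lowerP (F_knots i) u0.
have [Kb _ minb] := upperP (F_knots i) u1.
have /andP[a0 _] := knot01 (F_knots i) Ka; have /andP[_ b1] := knot01 (F_knots i) Kb.
rewrite /interp /weight -/u.
move: (lower (F i) u) (upper (F i) u) Ka maxa Kb minb a0 b1 au ub =>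
  a b Ka maxa Kb minb a0 b1 au ub.
have subI : `]a, b[%classic `<=` `[0, 1]%classic `\` F i.
  move=> v /=; rewrite !in_itv /= => /andP[av vb]; split; first by lra.
  move=> Fv; have [vu|uv] := leP v u; first by have := maxa _ Fv vu; lra.
  by have := minb _ Fv (ltW uv); lra.
have [p [q gI]] := gaff i t ct _ (@interval_is_interval _ _) subI.
have ab : a < b by lra.
have gcl c : a <= c <= b -> g (set_coord t i c) = p * c + q.
  move=> cab; apply: affine_closure gC ct _ gI _ _.
  - by move=> v /subI[].
  - exact: closure_itv_oo.
  - by lra.
rewrite !gcl ?lexx ?(ltW ab)// -[in RHS](set_coord_id t i) gcl -/u; last by lra.
by field; rewrite subr_eq0 gt_eqF.
Qed.

Lemma interp_coords_extension r f g t : is_multiaffine_extension F f g ->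
  unit_cube t -> interp_coords r g t = g t.
Proof.
move=> fg; elim: r t => //= i r IH t ct.
rewrite -[RHS](extension_interp_id i fg ct) /interp.
have t01 : 0 <= t ord0 i <= 1 by have := ct i; rewrite /= in_itv.
have /andP[t0 t1] := t01.
have [/(knot01 (F_knots i)) Ka _ _] := lowerP (F_knots i) t0.
have [/(knot01 (F_knots i)) Kb _ _] := upperP (F_knots i) t1.
by rewrite !IH//; exact: cube_set_coord.
Qed.

(** The interpolant of g sees only the values of g at the knots, where g and f
    agree. *)
Lemma extension_unique f g t : is_multiaffine_extension F f g ->
  unit_cube t -> g t = interp_coords (enum 'I_d) f t.
Proof.
move=> fg ct; rewrite -(interp_coords_extension (enum 'I_d) fg ct).
apply/eqP; rewrite -subr_eq0 -normr_le0.
apply: interp_coords_dist; rewrite ?enum_uniq ?prod_cells_enum// => x Fx.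
by have [_ gf _] := fg; rewrite gf// subrr normr0.
Qed.

Lemma multiaffine_extensionP f g : is_multiaffine_extension F f g ->
  is_multiaffine_extension F f (multiaffine_extension F f).
Proof. by move=> fg; apply: xgetPex; exists g. Qed.

Lemma multiaffine_extensionE f g t : is_multiaffine_extension F f g ->
  unit_cube t -> multiaffine_extension F f t = g t.
Proof.
move=> fg ct; rewrite (extension_unique fg ct).
exact: extension_unique (multiaffine_extensionP fg) ct.
Qed.

Lemma multiaffine_extension_dist f g M :
  {within prod_set F, continuous f} -> {within prod_set F, continuous g} ->
  (forall t, prod_set F t -> `|f t - g t| <= M) -> forall t, unit_cube t ->
  `|multiaffine_extension F f t - multiaffine_extension F g t| <= M.
Proof.
move=> /interp_coords_is_extension fC /interp_coords_is_extension gC fgM t ct.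
rewrite (multiaffine_extensionE fC ct) (multiaffine_extensionE gC ct).
by apply: interp_coords_dist; rewrite ?enum_uniq ?prod_cells_enum.
Qed.

End Extension.

(** * The span of the tensor products of hat functions *)

Section Span.
Variable R : realType.

Lemma affine_on_scale (I : set R) h c : affine_on I h -> affine_on I (fun u => c * h u).
Proof. by move=> [p [q hE]]; exists (c * p), (c * q) => u Iu; rewrite hE//; ring. Qed.

Lemma affine_on_sum (T : Type) (r : seq T) (I : set R) (h : T -> R -> R) :
  (forall k, affine_on I (h k)) -> affine_on I (fun u => \sum_(k <- r) h k u).
Proof.
move=> hI; elim: r => [|k r [p [q hE]]].
  by exists 0, 0 => u _; rewrite big_nil; ring.
have [p' [q' hE']] := hI k.
by exists (p' + p), (q' + q) => u Iu; rewrite big_cons hE// hE'//; ring.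
Qed.

Lemma eq_affine_on (I : set R) h h' :
  (forall u, I u -> h u = h' u) -> affine_on I h' -> affine_on I h.
Proof. by move=> hh' [p [q hE]]; exists p, q => u Iu; rewrite hh'// hE. Qed.

Lemma interval_side (I : set R) c : is_interval I -> ~ I c ->
  (forall x, I x -> x < c) \/ (forall x, I x -> c < x).
Proof.
move=> itvI nIc; have [[x [Ix xc]]|no] := pselect (exists x, I x /\ x < c).
- left=> y Iy; rewrite ltNge; apply/negP => cy; apply: nIc.
  by apply: (itvI x y) => //; rewrite (ltW xc).
- right=> x Ix; rewrite ltNge le_eqVlt; apply/negP => /orP[/eqP e|xc].
    by apply: nIc; rewrite -e.
  by apply: no; exists x.
Qed.

Lemma hat_affine_on (u v w : R) (I : set R) : u < v < w -> is_interval I ->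
  ~ I u -> ~ I v -> ~ I w -> affine_on I (hat u v w).
Proof.
move=> /andP[uv vw] itvI nu nv nw; rewrite /hat.
have [Iu|uI] := interval_side itvI nu.
  exists 0, 0 => x /Iu xu; rewrite !ifF; first by ring.
    by apply/negbTE; lra.
  by apply/negbTE; lra.
have [Iv|vI] := interval_side itvI nv.
  exists (v - u)^-1, (- u / (v - u)) => x Ix.
  by rewrite ifT ?(ltW (uI _ Ix)) ?(ltW (Iv _ Ix))//; ring.
have [Iw|wI] := interval_side itvI nw.
  exists (- (w - v)^-1), (w / (w - v)) => x Ix; have xv := vI _ Ix.
  rewrite ifF; last by apply/negbTE; lra.
  by rewrite ifT ?(ltW xv) ?(ltW (Iw _ Ix))//; ring.
exists 0, 0 => x /wI wx; rewrite !ifF; first by ring.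
  by apply/negbTE; lra.
by apply/negbTE; lra.
Qed.

(** A description without case distinction, from which continuity is immediate. *)
Lemma hatE (u v w x : R) : u < v < w ->
  hat u v w x = Num.max 0 (Num.min ((x - u) / (v - u)) ((w - x) / (w - v))).
Proof.
move=> /andP[uv vw]; have p1 : 0 < v - u by lra.
have p2 : 0 < w - v by lra.
rewrite /hat; case: (leP u x) => ux /=; last first.
  have -> : (v <= x) = false by apply/negbTE; lra.
  have h : (x - u) / (v - u) < 0 by rewrite ltr_pdivrMr; lra.
  rewrite /=; apply/esym/max_idPl; rewrite ge_min; apply/orP; left; exact: ltW.
have h0 : 0 <= (x - u) / (v - u) by rewrite divr_ge0; lra.
have [xv|vx] := leP x v.
  have h1 : (x - u) / (v - u) <= 1 by rewrite ler_pdivrMr; lra.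
  have h2 : 1 <= (w - x) / (w - v) by rewrite ler_pdivlMr; lra.
  by rewrite min_l ?max_r//; exact: le_trans h2.
rewrite (ltW vx) /=; have h1 : 1 <= (x - u) / (v - u) by rewrite ler_pdivlMr; lra.
have h2 : (w - x) / (w - v) <= 1 by rewrite ler_pdivrMr; lra.
rewrite min_r; last exact: le_trans h1.
have [xw|wx] := leP x w; first by rewrite max_r// divr_ge0; lra.
by rewrite max_l// ltW// ltr_pdivrMr; lra.
Qed.

Lemma hat_continuous (u v w : R) : u < v < w -> continuous (hat u v w).
Proof.
move=> uvw; have -> : hat u v w = (fun x : R => 0 : R^o) \max
    ((fun x : R => ((x - u) / (v - u) : R^o)) \min (fun x => (w - x) / (w - v) : R^o)).
  by apply/funext => x; rewrite hatE.
move=> x; apply: continuous_max; first exact: cst_continuous.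
apply: continuous_min; apply: cvgM; try exact: cvg_cst;
  (apply: cvgB; first [exact: cvg_cst|exact: cvg_id]).
Qed.

Lemma subdivision_lt (s : seq R) (l : 'I_(subdiv_size s)) : is_subdivision s ->
  s`_l < s`_l.+1 < s`_l.+2.
Proof.
move=> [ss _ _ _ _]; have ls : (l < (size s).-2)%N := ltn_ord l.
have l2 : (l.+2 < size s)%N by lia.
by move/(sortedP 0): ss => ss; rewrite !ss// ltnW.
Qed.

Lemma subdivision_mem (s : seq R) (l : 'I_(subdiv_size s)) :
  [/\ s`_l \in s, s`_l.+1 \in s & s`_l.+2 \in s].
Proof.
have ls : (l < (size s).-2)%N := ltn_ord l.
have l2 : (l.+2 < size s)%N by lia.
by split; apply: mem_nth => //; rewrite ltnW// ltnW.
Qed.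

Lemma subdivision_mem0 (s : seq R) : is_subdivision s -> 0 \in s.
Proof.
move=> [_ _ s1 _ s2]; rewrite -[X in X \in _]s1; apply: mem_nth.
case: s s1 s2 => [|a [|b s]] //= _ e; lra.
Qed.

Section SpanExtension.
Variables (d : nat) (F : 'I_d -> set R) (S : 'I_d -> seq R).
Hypotheses (F_knots : forall i, knot_set (F i))
  (S_subdiv : forall i, is_subdivision (S i))
  (S_sub : prod_set (fun i => [set` S i]) `&` @unit_cube R d `<=` prod_set F).

(** An inclusion between products passes to the factors because the remaining
    factors contain 0. *)
Lemma subdivision_knot i x : x \in S i -> 0 <= x <= 1 -> F i x.
Proof.
move=> Sx x01; suff St : (prod_set (fun i => [set` S i]) `&` @unit_cube R d)
    (set_coord 0 i x) by have := S_sub St i; rewrite set_coordE eqxx.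
split=> j; rewrite /= mxE; have [e|_] := eqVneq j i; rewrite ?mxE ?in_itv /= ?e// ?lexx ?ler01//.
exact: subdivision_mem0.
Qed.

Lemma subdiv_basis_continuous l : continuous (@subdiv_basis R d S l).
Proof.
move=> t; apply: cvg_big => [| |i _]; [exact: mul_continuous|exact: nbhs_filter|].
apply: (@cvg_comp _ _ _ (fun t : 'rV[R]_d => t ord0 i)); first exact: coord_continuous.
exact: hat_continuous (subdivision_lt _ (S_subdiv i)) _.
Qed.

Lemma subdiv_basis_affine l i (t : 'rV[R]_d) (I : set R) :
  is_interval I -> I `<=` `[0, 1]%classic `\` F i ->
  affine_on I (fun u => @subdiv_basis R d S l (set_coord t i u)).
Proof.
move=> itvI subI.
have SI x : x \in S i -> ~ I x.
  by move=> Sx /subI[/=]; rewrite in_itv /= => x01; apply; exact: subdivision_knot.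
have [/SI n1 /SI n2 /SI n3] := subdivision_mem (l i).
have := affine_on_scale
  (\prod_(j < d | j != i) hat (S j)`_(l j) (S j)`_(l j).+1 (S j)`_(l j).+2 (t ord0 j))
  (hat_affine_on (subdivision_lt (l i) (S_subdiv i)) itvI n1 n2 n3).
apply: eq_affine_on => u _; rewrite /subdiv_basis (bigD1 i)//= set_coordE eqxx mulrC.
by congr (_ * _); apply: eq_bigr => j ji; rewrite set_coordE (negbTE ji).
Qed.

Lemma subdiv_span_extension f : subdiv_span S f ->
  is_multiaffine_extension F (f \_ (prod_set F)) f.
Proof.
move=> [c fE]; split=> [|t Ft|i t ct I itvI subI].
- apply: (@subspace_eq_continuous _ _ _
    (fun t => \sum_(l : subdiv_index S) c l * subdiv_basis l t)).
    by move=> t /set_mem ct; exact/esym/fE.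
  apply: continuous_subspaceT => t; apply: cvg_big => [| |l _].
  + exact: add_continuous.
  + exact: nbhs_filter.
  + exact: (cvgM (cvg_cst (c l)) (@subdiv_basis_continuous l t)).
- by rewrite patchE mem_set.
- apply: (eq_affine_on (h' := fun u =>
    \sum_(l : subdiv_index S) c l * subdiv_basis l (set_coord t i u))).
    move=> u /subI[/=]; rewrite in_itv /= => u01 _.
    by apply: fE; exact: cube_set_coord.
  by apply: affine_on_sum => l; apply: affine_on_scale; exact: subdiv_basis_affine.
Qed.

End SpanExtension.

End Span.

(** * The extension operator *)

Theorem proposition2 (R : realType) (d : nat) (F : 'I_d -> set R)
    (F_closed : forall i, closed (F i))
    (F_sub : forall i, F i `<=` `[0, 1]%classic)
    (F_0 : forall i, F i 0) (F_1 : forall i, F i 1) :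
  let P := multiaffine_extension F in
  let C (A : set 'rV[R]_d) := [set f : 'rV[R]_d -> R | {within A, continuous f}] in
  [/\ (* P maps C(F, R) to C([0,1]^d, R) *)
      forall f, C (prod_set F) f -> C (@unit_cube R d) (P f),
      (* P is affine *)
      forall f g, C (prod_set F) f -> C (prod_set F) g ->
        forall (a : R) (t : 'rV[R]_d), unit_cube t ->
          P (fun x => a * f x + (1 - a) * g x) t = a * P f t + (1 - a) * P g t,
      (* P is 1-Lipschitz *)
      forall f g, C (prod_set F) f -> C (prod_set F) g ->
        sup_norm (@unit_cube R d) (P f \- P g) <= sup_norm (prod_set F) (f \- g),
      (* P preserves uniform convergence *)
      forall (I : Type) (G : set_system I), Filter G ->
        forall (u : I -> 'rV[R]_d -> R) (f : 'rV[R]_d -> R),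
          (forall n, C (prod_set F) (u n)) -> C (prod_set F) f ->
          {uniform prod_set F, u @ G --> f} ->
          {uniform @unit_cube R d, (fun n => P (u n)) @ G --> P f} &
      (* P fixes E_S *)
      forall S : 'I_d -> seq R, (forall i, is_subdivision (S i)) ->
        prod_set (fun i => [set` S i]) `&` @unit_cube R d `<=` prod_set F ->
        forall f, subdiv_span S f ->
          forall t, unit_cube t -> P (f \_ (prod_set F)) t = f t].
Proof.
move=> P C; have HF i : knot_set (F i) by [].
have ext f : C (prod_set F) f -> is_multiaffine_extension F f (P f).
  by move=> fC; exact: multiaffine_extensionP (interp_coords_is_extension HF fC).
have PE f t : C (prod_set F) f -> unit_cube t -> P f t = interp_coords F (enum 'I_d) f t.
  by move=> /ext; exact: extension_unique.
have dist f g M : C (prod_set F) f -> C (prod_set F) g ->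
    (forall t, prod_set F t -> `|f t - g t| <= M) ->
    forall t, unit_cube t -> `|P f t - P g t| <= M.
  exact: multiaffine_extension_dist.
split.
- by move=> f /ext[].
- move=> f g fC gC a t ct; rewrite !PE//; first exact: interp_coords_linear.
  move=> x; apply: cvgD; apply: cvgM; try exact: cvg_cst; [exact: fC|exact: gC].
- move=> f g fC gC.
  have fgC : C (prod_set F) (f \- g) by move=> x; apply: cvgB; [exact: fC|exact: gC].
  have [M hM] := continuous_prod_bounded HF fgC.
  have t0 : prod_set F 0 by move=> i; rewrite mxE.
  apply: ge_sup; first by exists `|(P f \- P g) 0|, 0 => //; exact: (prod_sub_cube HF).
  move=> _ [t ct <-]; apply: dist => // s Fs; apply: ub_le_sup; last by exists s.
  by exists M => _ [x Fx <-]; exact: hM.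
- move=> I G GF u f uC fC uf W /uniform_nbhs[E [entE subE]].
  rewrite -entourage_ballE in entE; have [e /= e0 subb] := entE.
  have e2 : 0 < e / 2 by lra.
  have near : G (u @^-1` [set h | forall y, prod_set F y -> `|f y - h y| < e / 2]).
    apply: uf; apply/uniform_nbhs; exists [set xy | ball xy.1 (e / 2) xy.2]; split => //.
    by rewrite -entourage_ballE; exists (e / 2).
  apply: filterS near => n /= hn; apply: subE => y cy; apply: subb => /=.
  rewrite /ball /=; apply: le_lt_trans (_ : e / 2 < e); last lra.
  by apply: dist => // t Ft; exact/ltW/hn.
- move=> S Ssub Ssubset f /(subdiv_span_extension Ssub Ssubset) fE t ct.
  exact: multiaffine_extensionE fE ct.
Qed.
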